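(* Suppose that for every $n$ the sequence $(X_{n,i})_{1\le i\le n}$ is stationary, that $r_n/s_n\in\mathbb N$ for all $n$, and that the limits $$c^{(s)}=\lim_{n\to\infty}\frac1{r_nv_ns_n^2a_n^2}\mathrm{Var}\Big(\sum_{i=1}^{r_n}g(Y_{n,i})\Big)\in(0,\infty),\qquad c^{(d)}=\lim_{n\to\infty}\frac1{r_nv_na_n^2}\mathrm{Var}\Big(\sum_{i=1}^{r_n/s_n}g(Y_{n,is_n+1})\Big)$$ exist. Suppose further that for some $\xi\in\mathbb R$ $$\frac1{s_nv_na_n}E[g(Y_{n,1})]\,\frac{n-s_n+1}{n}\to\xi ,$$ that $g$ is bounded and does not change its sign, that $s_n=o(r_na_n)$ and that $s_nv_n\to0$. If, in addition, there exists a sequence $k_n=o(r_na_n)$ of natural numbers such that $$\sum_{i=k_n}^{r_n}\beta^X_{n,i}=o(r_nv_na_n),$$ then $\tilde c^{(s)}\le\tilde c^{(d)}$, where $\tilde c^{(\sharp)}:=c^{(\sharp)}+\xi^2c^{(v)}-2\xi c^{(\sharp,v)}$ for $\sharp\in\{s,d\}$.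
   Context: All limits and $o$ are for $n\to\infty$. $(E,\|\cdot\|)$ is a complete normed vector space, $E_\cup:=\bigcup_{k\in\mathbb N}E^k$, and $(X_{n,i})_{1\le i\le n,\,n\in\mathbb N}$ is a triangular array of $E$-valued random variables. $s_n,r_n\in\mathbb N$ are sequences with $s_n=o(r_n)$ and $r_n=o(n)$; $Y_{n,j}:=(X_{n,j},\dots,X_{n,j+s_n-1})$ are blocks of length $s_n$; $v_n:=P\{X_{n,1}\ne0\}$ with $v_n>0$, $v_n\to0$; $a_n>0$ are normalizing constants. $g:E_\cup\to\mathbb R$ is a measurable functional which vanishes on null vectors. The following limits are assumed to exist in $\mathbb R$: $$c^{(s,v)}:=\lim_{n\to\infty}\frac1{r_nv_ns_na_n}\mathrm{Cov}\Big(\sum_{i=1}^{r_n}g(Y_{n,i}),\sum_{i=1}^{r_n}\mathbf 1_{\{X_{n,i}\ne0\}}\Big),$$ $$c^{(d,v)}:=\lim_{n\to\infty}\frac1{r_nv_na_n}\mathrm{Cov}\Big(\sum_{j=1}^{r_n/s_n}g(Y_{n,(j-1)s_n+1}),\sum_{i=1}^{r_n}\mathbf 1_{\{X_{n,i}\ne0\}}\Big),$$ $$c^{(v)}:=\lim_{n\to\infty}\frac1{r_nv_n}E\Big[\Big(\sum_{i=1}^{r_n}\mathbf 1_{\{X_{n,i}\ne0\}}\Big)^2\Big].$$ Mixing coefficients: $\beta^X_{n,k}:=\sup_{1\le l\le n-k-1}E\big[\sup_{B\in\mathcal B_{n,l+k+1}^n}|P(B\mid\mathcal B_{n,1}^l)-P(B)|\big]$,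 where $\mathcal B_{n,i}^j$ is the $\sigma$-field generated by $(X_{n,l})_{i\le l\le j}$. ($\tilde c^{(s)}$ and $\tilde c^{(d)}$ are the asymptotic variances of the sliding and disjoint blocks estimators of $\xi$, i.e. of $\frac{1}{s_na_n}\sum_{i=1}^{n-s_n+1}g(Y_{n,i})$ and $\frac1{a_n}\sum_{i=1}^{\lfloor n/s_n\rfloor}g(Y_{n,(i-1)s_n+1})$, each divided by $\sum_{i=1}^{n-s_n+1}\mathbf 1_{\{X_{n,i}\ne0\}}$.) *)

(* Defs.v *)
From HB Require Import structures.
From mathcomp Require Import all_boot all_order all_algebra.
From mathcomp Require Import all_classical all_reals all_analysis.
From mathcomp Require Import measurable_realfun.

Set Implicit Arguments.
Unset Strict Implicit.
Unset Printing Implicit Defensive.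

Import Order.TTheory GRing.Theory Num.Theory.
Import numFieldNormedType.Exports.

Local Open Scope classical_set_scope.
Local Open Scope ring_scope.

(* A copy of the space E carrying its Borel sigma-algebra; [k.-tuple (borel E)]
   then carries the product of k copies of it. *)
Notation borel E := (g_sigma_algebraType (@open E)).

(* Functionals on the disjoint union of the E^k, k >= 1, are functions on
   [seq E]; their value at the empty sequence is irrelevant and unconstrained. *)
Section functionals.
Context {R : realType} {E : normedModType R}.
Implicit Type g : seq E -> R.

Definition measurable_functional g :=
  forall k, (0 < k)%N -> measurable_fun [set: k.-tuple (borel E)] g.

Definition vanishes_on_null g := forall k, (0 < k)%N -> g (nseq k 0) = 0.

Definition bounded_functional g :=
  exists M : R, forall y, y != [::] -> `|g y| <= M.

Definition constant_sign g :=
  (forall y, y != [::] -> 0 <= g y) \/ (forall y, y != [::] -> g y <= 0).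

End functionals.

(* One row of the array: x i stands for X_{n,i}, and only the indices
   1 <= i <= n are meaningful. *)
Section row.
Context {R : realType} {E : normedModType R}.
Context {d : measure_display} {T : measurableType d}.
Implicit Type x : nat -> T -> E.

Definition random_row (n : nat) x :=
  forall i, (1 <= i <= n)%N -> measurable_fun [set: T] (x i : T -> borel E).

(* (x_j, ..., x_{j+m-1}) *)
Definition block x (j m : nat) (w : T) : m.-tuple E :=
  [tuple x (j + i)%N w | i < m].

Definition stationary (P : probability T R) (n : nat) x :=
  forall k h, (k + h <= n)%N ->
    forall A : set (k.-tuple (borel E)), measurable A ->
      P [set w | A (block x h.+1 k w)] = P [set w | A (block x 1 k w)].

Definition sliding_sum (g : seq E -> R) x (s r : nat) (w : T) : R :=
  \sum_(1 <= i < r.+1) g (block x i s w).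

Definition disjoint_sum (g : seq E -> R) x (s r : nat) (w : T) : R :=
  \sum_(1 <= j < (r %/ s).+1) g (block x (j.-1 * s).+1 s w).

(* as disjoint_sum, but with the blocks starting at i * s + 1 *)
Definition shifted_disjoint_sum (g : seq E -> R) x (s r : nat) (w : T) : R :=
  \sum_(1 <= i < (r %/ s).+1) g (block x (i * s).+1 s w).

Definition nonzero_count x (r : nat) (w : T) : R :=
  \sum_(1 <= i < r.+1) (x i w != 0)%:R.

Definition nonzero_prob (P : probability T R) x : R :=
  fine (P [set w | x 1%N w != 0]).

(* the sigma-field generated by x_i, ..., x_j *)
Definition sigma_field x (i j : nat) : set (set T) :=
  <<s \bigcup_(l in [set l | (i <= l <= j)%N])
        preimage_set_system [set: T] (x l : T -> borel E) measurable >>.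

End row.

Section mixing.
Context {R : realType} {d : measure_display} {T : measurableType d}.
Variable P : probability T R.
Local Open Scope ereal_scope.

Definition is_cond_prob (G : set (set T)) (B : set T) (f : T -> R) :=
  [/\ measurable_fun [set: g_sigma_algebraType G] f,
      P.-integrable [set: T] (EFin \o f) &
      forall A, G A -> \int[P]_(w in A) (f w)%:E = P (A `&` B)].

(* A version of P(B | G); one exists, by the Radon-Nikodym theorem, when G is
   a sub-sigma-algebra and B is an event. *)
Definition cond_prob (G : set (set T)) (B : set T) : T -> R :=
  xget (cst 0%R) [set f | is_cond_prob G B f].

Definition ae_upper_bound (F : set (T -> \bar R)) (Z : T -> \bar R) :=
  measurable_fun [set: T] Z /\
  forall f, F f -> {ae P, forall w, f w <= Z w}.

Definition is_ess_sup (F : set (T -> \bar R)) (Z : T -> \bar R) :=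
  ae_upper_bound F Z /\
  forall Z', ae_upper_bound F Z' -> {ae P, forall w, Z w <= Z' w}.

(* Conditional probabilities are only defined almost surely, so the supremum
   over uncountably many events in the mixing coefficient is the essential
   supremum; it exists for every family of measurable functions and is unique
   up to almost sure equality. *)
Definition ess_sup_family (F : set (T -> \bar R)) : T -> \bar R :=
  xget (cst +oo) [set Z | is_ess_sup F Z].

(* The supremum over 1 <= l <= n - k - 1 is a finite maximum; it is 0 when
   there is no such l. *)
Definition beta_mixing {E : normedModType R} (n : nat) (x : nat -> T -> E)
    (k : nat) : \bar R :=
  \big[maxe/0]_(1 <= l < n - k)
    \int[P]_w ess_sup_family
      [set (fun w => `|cond_prob (sigma_field x 1 l) B w - fine (P B)|%:E)
         | B in sigma_field x (l + k + 1) n] w.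

End mixing.

Definition asymptotic_variance {R : realType} (c cv csv xi : R) : R :=
  c + xi ^+ 2 * cv - 2 * xi * csv.

(* Main.v *)
Require Import Defs.
From HB Require Import structures.
From mathcomp Require Import all_boot all_order all_algebra.
From mathcomp Require Import all_classical all_reals all_analysis.
From mathcomp Require Import measurable_realfun.
From mathcomp Require Import lra ring zify.

Set Implicit Arguments.
Unset Strict Implicit.
Unset Printing Implicit Defensive.

Import Order.TTheory GRing.Theory Num.Theory.
Import numFieldNormedType.Exports.

Local Open Scope classical_set_scope.
Local Open Scope ring_scope.

(* Write r = m s and let D_h be the sum of g over the m disjoint blocks starting
   at h + 1, h + s + 1, ..., so that D_0 and D_s are the two versions of the
   disjoint blocks sum and the sliding blocks sum is S = D_0 + ... + D_(s-1).
   Stationarity gives Var D_h = Var D_0, hence Var S <= s^2 Var D_0 and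
   c^(s) <= c^(d).  The covariances with the number N of nonzero observations
   agree in the limit: if N_h counts the nonzero observations at h + 1, ...,
   h + r, then Cov (D_h, N_h) = Cov (D_0, N), and N_h and N differ only near the
   two ends.  There, each pair of a block and an observation separated by a
     gap q
   contributes at most 2 M v, and also at most 2 M beta_q, and all but s of the
   pairs at either end have distinct gaps q < r.  Using the first bound for
   q < k and the second one for q >= k yields
   |Cov (S, N) - s Cov (D_0, N)| <= s C (s v + k v + sum_(k <= q <= r) beta_q),
   so c^(s,v) = c^(d,v). *)

(** * Bounded random variables *)

Section bounded_random_variables.
Context {R : realType} {d : measure_display} {T : measurableType d}.

(** No probability enters, so the predicate also covers functionals on tuple spaces. The bound holds
    everywhere, which makes products integrable. *)
Definition bounded_rv (f : T -> R) :=
  measurable_fun [set: T] f /\ exists M, forall w, `|f w| <= M.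

Lemma bounded_rv_cst c : bounded_rv (fun=> c).
Proof. by split; [exact: measurable_cst|exists `|c|]. Qed.

Lemma bounded_rvD f h :
  bounded_rv f -> bounded_rv h -> bounded_rv (fun w => f w + h w).
Proof.
move=> [mf [M fM]] [mh [K hK]]; split; first exact: measurable_funD.
by exists (M + K) => w; rewrite (le_trans (ler_normD _ _))// lerD.
Qed.

Lemma bounded_rvM f h :
  bounded_rv f -> bounded_rv h -> bounded_rv (fun w => f w * h w).
Proof.
move=> [mf [M fM]] [mh [K hK]]; split; first exact: measurable_funM.
by exists (M * K) => w; rewrite normrM ler_pM.
Qed.

Lemma bounded_rvZ c f : bounded_rv f -> bounded_rv (fun w => c * f w).
Proof. exact/bounded_rvM/bounded_rv_cst. Qed.

Lemma bounded_rvB f h :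
  bounded_rv f -> bounded_rv h -> bounded_rv (fun w => f w - h w).
Proof.
move=> bf /(bounded_rvZ (-1)) bh; have := bounded_rvD bf bh.
by under eq_fun do rewrite mulN1r.
Qed.

Lemma bounded_rv_sum (I : eqType) (r : seq I) (F : I -> T -> R) :
  (forall i, i \in r -> bounded_rv (F i)) ->
  bounded_rv (fun w => \sum_(i <- r) F i w).
Proof.
elim: r => [_|i r IH bF].
  by under eq_fun do rewrite big_nil; exact: bounded_rv_cst.
under eq_fun do rewrite big_cons.
apply: bounded_rvD; first by apply: bF; rewrite mem_head.
by apply: IH => j jr; apply: bF; rewrite inE jr orbT.
Qed.

Lemma bounded_rv_indic (A : set T) :
  measurable A -> bounded_rv (\1_A : T -> R).
Proof.
move=> mA; split; first exact: measurable_indic.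
by exists 1 => w; rewrite indicE; case: (_ \in _); rewrite ?normr1 ?normr0.
Qed.

Variable P : probability T R.

Lemma bounded_rv_integrable f :
  bounded_rv f -> P.-integrable [set: T] (EFin \o f).
Proof.
move=> [mf [M fM]]; apply: measurable_bounded_integrable => //.
  exact: fin_num_fun_lty.
exists M; split=> [|x Mx w _]; first exact: num_real.
by rewrite /= (le_trans (fM w)) ?ltW.
Qed.

Lemma Rintegral_sum (I : eqType) (r : seq I) (F : I -> T -> R) :
  (forall i, i \in r -> bounded_rv (F i)) ->
  \int[P]_w (\sum_(i <- r) F i w) = \sum_(i <- r) \int[P]_w F i w.
Proof.
elim: r => [_|i r IH bF].
  rewrite big_nil; under eq_Rintegral do rewrite big_nil.
  by rewrite Rintegral_cst// mul0r.
have bi : bounded_rv (F i) by apply: bF; rewrite mem_head.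
have br j : j \in r -> bounded_rv (F j).
  by move=> jr; apply: bF; rewrite inE jr orbT.
rewrite big_cons -IH//; under eq_Rintegral do rewrite big_cons.
by rewrite RintegralD//; apply: bounded_rv_integrable => //;
  exact: bounded_rv_sum.
Qed.

(** A real-valued covariance; [bounded_covarianceE] identifies it with the extended-real one on
    bounded variables. *)
Definition rcov (f h : T -> R) : R :=
  \int[P]_w (f w * h w) - \int[P]_w f w * \int[P]_w h w.

Lemma rcovC f h : rcov f h = rcov h f.
Proof. by rewrite /rcov mulrC; under eq_Rintegral do rewrite mulrC. Qed.

Lemma bounded_rv_Lfun1 f : bounded_rv f -> f \in Lfun P 1.
Proof. by move=> bf; apply/Lfun1_integrable/bounded_rv_integrable. Qed.

Lemma bounded_covarianceE f h : bounded_rv f -> bounded_rv h ->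
  covariance P f h = (rcov f h)%:E.
Proof.
move=> bf bh; have bfh := bounded_rvM bf bh.
rewrite covarianceE; try exact: bounded_rv_Lfun1.
rewrite /rcov /Rintegral EFinB EFinM !fineK; try by rewrite unlock.
all: exact/integrable_fin_num/bounded_rv_integrable.
Qed.

Lemma rcov_suml (I : eqType) (r : seq I) (F : I -> T -> R) h :
  (forall i, i \in r -> bounded_rv (F i)) -> bounded_rv h ->
  rcov (fun w => \sum_(i <- r) F i w) h = \sum_(i <- r) rcov (F i) h.
Proof.
move=> bF bh; rewrite /rcov sumrB -mulr_suml -!Rintegral_sum//.
  by congr (_ - _); apply: eq_Rintegral => w _; rewrite mulr_suml.
by move=> i ir; apply: bounded_rvM => //; exact: bF.
Qed.

Lemma rcov_sumr (I : eqType) (r : seq I) (F : I -> T -> R) h :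
  (forall i, i \in r -> bounded_rv (F i)) -> bounded_rv h ->
  rcov h (fun w => \sum_(i <- r) F i w) = \sum_(i <- r) rcov h (F i).
Proof.
by move=> bF bh; rewrite rcovC rcov_suml//; apply: eq_bigr => i _; exact: rcovC.
Qed.

Lemma rcovDl f1 f2 h : bounded_rv f1 -> bounded_rv f2 -> bounded_rv h ->
  rcov (fun w => f1 w + f2 w) h = rcov f1 h + rcov f2 h.
Proof.
move=> b1 b2 bh; rewrite /rcov; under eq_Rintegral do rewrite mulrDl.
rewrite !RintegralD//; try apply: bounded_rv_integrable => //;
  try exact: bounded_rvM.
by ring.
Qed.

Lemma rcovZl c f h : bounded_rv f -> bounded_rv h ->
  rcov (fun w => c * f w) h = c * rcov f h.
Proof.
move=> bf bh; rewrite /rcov; under eq_Rintegral do rewrite -mulrA.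
rewrite !RintegralZl//; try apply: bounded_rv_integrable => //;
  try exact: bounded_rvM.
by ring.
Qed.

Lemma rcovBl f1 f2 h : bounded_rv f1 -> bounded_rv f2 -> bounded_rv h ->
  rcov (fun w => f1 w - f2 w) h = rcov f1 h - rcov f2 h.
Proof.
move=> b1 b2 bh.
rewrite -mulN1r -rcovZl// -rcovDl//; last exact: bounded_rvZ.
by congr rcov; apply/funext => w; rewrite mulN1r.
Qed.

Lemma rcovBr f1 f2 h : bounded_rv f1 -> bounded_rv f2 -> bounded_rv h ->
  rcov h (fun w => f1 w - f2 w) = rcov h f1 - rcov h f2.
Proof. by move=> *; rewrite rcovC rcovBl// !(rcovC _ h). Qed.

Lemma Rintegral_probability_cst (c : R) : \int[P]_w c = c.
Proof.
have := probability_setT P; rewrite Rintegral_cst// => PT.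
by rewrite [X in fine X]PT mulr1.
Qed.

Lemma rcov_cstl c h : bounded_rv h -> rcov (fun=> c) h = 0.
Proof.
move=> bh; rewrite /rcov RintegralZl//; last exact: bounded_rv_integrable.
by rewrite Rintegral_probability_cst subrr.
Qed.

Lemma rcov_ge0 f : bounded_rv f -> 0 <= rcov f f.
Proof.
move=> bf; rewrite -lee_fin -bounded_covarianceE//.
exact: variance_ge0.
Qed.

(* From [0 <= Var (f - h)]. *)
Lemma rcov_le f h : bounded_rv f -> bounded_rv h ->
  2 * rcov f h <= rcov f f + rcov h h.
Proof.
move=> bf bh; have := rcov_ge0 (bounded_rvB bf bh).
rewrite rcovBl ?rcovBr//; [|exact: bounded_rvB].
by rewrite (rcovC h f); lra.
Qed.

(** By bilinearity the left-hand side is a sum of [m ^ 2] covariances, each at most [V] by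
    [rcov_le]. *)
Lemma rcov_sum_le (m : nat) (F : nat -> T -> R) V :
  (forall i, (i < m)%N -> bounded_rv (F i)) ->
  (forall i, (i < m)%N -> rcov (F i) (F i) = V) ->
  rcov (fun w => \sum_(0 <= i < m) F i w) (fun w => \sum_(0 <= i < m) F i w)
    <= m%:R ^+ 2 * V.
Proof.
move=> bF vF; have bF' i : i \in index_iota 0 m -> bounded_rv (F i).
  by rewrite mem_index_iota => /andP[_]; exact: bF.
rewrite rcov_suml//; last exact: bounded_rv_sum.
have -> : m%:R ^+ 2 * V = \sum_(0 <= i < m) \sum_(0 <= j < m) V.
  by rewrite !sumr_const_nat subn0 -mulrnA -[in RHS]mulr_natl natrM expr2.
apply: ler_sum_nat => i /andP[_ im]; rewrite rcov_sumr//; last exact: bF.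
apply: ler_sum_nat => j /andP[_ jm].
by have := rcov_le (bF _ im) (bF _ jm); rewrite !vF//; lra.
Qed.

Lemma le_normr_rcov_indic (f : T -> R) (M : R) A : measurable A ->
  measurable_fun [set: T] f -> (forall w, `|f w| <= M) ->
  `|rcov f \1_A| <= 2 * M * fine (P A).
Proof.
move=> mA mf fM; have bf : bounded_rv f by split => //; exists M.
have bA := bounded_rv_indic mA.
have iA : \int[P]_w \1_A w = fine (P A).
  by rewrite /Rintegral integral_indic// setIT.
have PA0 : 0 <= fine (P A) by exact: fine_ge0.
have h1 : `|\int[P]_w (f w * \1_A w)| <= M * fine (P A).
  have bfA := bounded_rvM bf bA.
  apply: (le_trans (le_normr_Rintegral _ (bounded_rv_integrable bfA))) => //.
  rewrite -iA -RintegralZl//; last exact: bounded_rv_integrable.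
  apply: le_Rintegral => //.
  - exact/integrable_norm/bounded_rv_integrable.
  - exact/bounded_rv_integrable/bounded_rvZ.
  - move=> w _; rewrite normrM ler_pM//.
    by rewrite indicE; case: (_ \in _); rewrite ?normr1 ?normr0.
have h2 : `|\int[P]_w f w| <= M.
  apply: (le_trans (le_normr_Rintegral _ (bounded_rv_integrable bf))) => //.
  rewrite -[leRHS]Rintegral_probability_cst.
  apply: le_Rintegral => //.
  - exact/integrable_norm/bounded_rv_integrable.
  - exact/bounded_rv_integrable/bounded_rv_cst.
rewrite /rcov iA (le_trans (ler_normB _ _))// -mulrA mulr2n mulrDl mul1r lerD//.
by rewrite normrM ler_pM// ger0_norm.
Qed.

End bounded_random_variables.

(** * Conditional probabilities and mixing coefficients *)

Section conditional_probability.
Context {R : realType} {d : measure_display} {T : measurableType d}.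
Variable P : probability T R.
Variables (G : set (set T)) (B : set T).
Hypotheses (sG : sigma_algebra [set: T] G) (Gm : G `<=` measurable).
Hypothesis mB : measurable B.

Lemma sigma_algebraType_measurableE (A : set T) :
  (measurable : set (set (g_sigma_algebraType G))) A = G A.
Proof. by rewrite measurable_g_measurableTypeE. Qed.

Lemma measurable_to_sub_sigma_algebra :
  measurable_fun [set: T] (id : T -> g_sigma_algebraType G).
Proof.
by move=> _ A mA; rewrite setTI; apply: Gm;
  rewrite -sigma_algebraType_measurableE.
Qed.

(** The version is a Radon-Nikodym derivative of [nu] with respect to [mu], the restrictions to [G]
    of the trace of [P] on [B] and of [P]. Restricting is a pushforward along the identity into [T]
    equipped with [G]. *)
Lemma cond_probP : is_cond_prob P G B (cond_prob P G B).
Proof.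
have mid := measurable_to_sub_sigma_algebra.
pose G' := g_sigma_algebraType G.
pose idf : {mfun T >-> G'} :=
  HB.pack (id : T -> G') (isMeasurableFun.Build _ _ _ _ _ mid).
pose mu : probability G' R := distribution P idf.
pose nu0 : {measure set G' -> \bar R} := pushforward (mrestr P mB)
  (id : T -> G').
have nufin : (nu0 mid setT < +oo)%E.
  by apply: (le_lt_trans (measureIr P measurableT mB));
    rewrite -ge0_fin_numE ?fin_num_measure.
pose nu : {finite_measure set G' -> \bar R} := mfrestr measurableT nufin.
have nuP (A : set T) : nu A = P (A `&` B) by rewrite /= /mfrestr /mrestr setIT.
have GT (A : set G') : measurable A -> measurable (A : set T).
  by rewrite sigma_algebraType_measurableE; exact: Gm.
have numu : nu `<< mu.
  apply/null_content_dominatesP => A mA muA0.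
  apply/eqP; rewrite -measure_le0 [leLHS]nuP; apply: le_trans (_ : P A <= 0)%E.
    by apply: le_measure; rewrite ?inE//; [apply: measurableI => //|];
      exact: GT.
  by rewrite [leLHS]muA0.
have [f [f0 ffin intf nuE]] := radon_nikodym_sigma_finite numu.
have intf' : P.-integrable [set: T] f.
  have /integrableP[mf ifoo] := intf.
  apply/integrableP; split; first exact: (measurableT_comp mf mid).
  move: ifoo; rewrite ge0_integral_pushforward//.
  exact: measurableT_comp.
(* [xgetP] leaves the case that no version exists, which [fine \o f] refutes. *)
rewrite /cond_prob; case: xgetP => [h hE //|/(_ (fine \o f))]; case.
have fE : EFin \o (fine \o f) = f by apply/funext => w /=; rewrite fineK.
split.
- apply: measurableT_comp => //.
  exact: (measurable_int _ intf).
- by rewrite fE.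
- move=> A GA; have mA : measurable (A : set G') by rewrite
  sigma_algebraType_measurableE.
  rewrite -nuP [RHS]nuE// ge0_integral_pushforward//.
    by apply: eq_integral => w _; rewrite /= fineK.
  exact/measurable_funTS/measurable_int/intf.
Qed.
End conditional_probability.

(** * Covariance bounds from conditional probabilities *)

Section mixing_bounds.
Context {R : realType} {d : measure_display} {T : measurableType d}.
Variable P : probability T R.

(* If the family has no essential supremum, its default value [+oo] still is an
   upper bound. *)
Lemma ess_sup_family_ae_upper_bound (F : set (T -> \bar R)) :
  ae_upper_bound P F (ess_sup_family P F).
Proof.
rewrite /ess_sup_family; case: xgetP => [Z _ []//|_].
by split=> [|f _]; [exact: measurable_cst|apply: aeW => w; rewrite leey].
Qed.

Lemma rcov_indicE (A B : set T) : measurable A -> measurable B ->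
  rcov P \1_A \1_B = fine (P (A `&` B)) - fine (P A) * fine (P B).
Proof.
move=> mA mB; rewrite /rcov /Rintegral !integral_indic// !setIT.
congr (fine _ - _); rewrite -[in RHS](setIT (A `&` B)) -integral_indic//;
  last exact: measurableI.
by apply: eq_integral => w _; rewrite indicI.
Qed.

(** Since [A] lies in [G], integrating [P(B | G) - P(B)] over [A] gives the covariance of the
    indicators. The absolute value of the integrand is almost surely below the essential supremum,
    as [B] is in [H]. *)
Lemma le_rcov_indic_ess_sup (G H : set (set T)) (A B : set T) :
  sigma_algebra [set: T] G -> G `<=` measurable -> H `<=` measurable ->
  G A -> H B ->
  (`|rcov P \1_A \1_B|%:E <= \int[P]_w ess_sup_family P
     [set (fun w => `|cond_prob P G B w - fine (P B)|%:E) | B in H] w)%E.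
Proof.
move=> sG Gm Hm GA HB; have mA := Gm _ GA; have mB := Hm _ HB.
have [mc ic cE] := cond_probP P sG Gm mB.
set c := cond_prob P G B in mc ic cE *; set F := [set _ | _ in _].
have [mZ] := ess_sup_family_ae_upper_bound F.
set Z := ess_sup_family P F in mZ *.
move=> /(_ _ (imageP _ HB)); rewrite -/c => cZ.
have icB : P.-integrable setT (fun w => (c w - fine (P B))%:E).
  have := integrableB measurableT ic
    (bounded_rv_integrable P (bounded_rv_cst (fine (P B)))).
  by apply: eq_integrable.
have -> : rcov P \1_A \1_B = \int[P]_(w in A) (c w - fine (P B)).
  rewrite RintegralB//; [|exact: integrableS ic|]; last first.
    apply: integrableS (bounded_rv_integrable P (bounded_rv_cst _)) => //.
  by rewrite rcov_indicE// Rintegral_cst// /Rintegral cE// [X in _ - X]mulrC.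
have icA : P.-integrable A (fun w => (c w - fine (P B))%:E) by exact:
  integrableS icB.
rewrite EFin_normr_Rintegral//.
apply: le_trans (le_abse_integral _ mA (measurable_int _ icA)) _.
have mcB : measurable_fun [set: T] (fun w => `|(c w - fine (P B))%:E|%E).
  by apply: measurableT_comp => //; exact: measurable_int icB.
(* [Z] is only known to be nonnegative almost surely; its positive part has the same integral and is
   nonnegative everywhere. *)
rewrite [leRHS](ae_eq_integral (fun w => maxe (Z w) 0%E))//; last 2 first.
- by apply: measurable_maxe.
- have := cZ; apply: filterS => w cZw _.
  by apply/esym/max_idPl/(le_trans _ cZw); rewrite lee_fin.
apply: le_trans (_ : \int[P]_w `|(c w - fine (P B))%:E|%E <= _)%E.
  by apply: ge0_subset_integral => //.
apply: ae_ge0_le_integral => //.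
- by move=> w _; rewrite le_max lexx orbT.
- by apply: measurable_maxe.
- have := cZ; apply: filterS => w cZw _.
  by rewrite le_max cZw.
Qed.

Lemma staircase (y : R) (Q : nat) : (0 <= y)%R ->
  \sum_(1 <= q < Q.+1) (q%:R <= y :> R)%:R = (minn Q (Num.truncn y))%:R :> R.
Proof.
move=> y0; elim: Q => [|Q IH]; first by rewrite big_geq// min0n.
rewrite big_nat_recr//= IH -truncn_ge_nat// -natrD; congr (_%:R).
by move: (Num.truncn y) => t; case: (leqP Q.+1 t) => /= h; lia.
Qed.

(* The indicators of the events [f >= q * K / Q], [1 <= q <= Q], approximate
   [f] uniformly up to [K / Q]. *)
Lemma le_rcov_level_sets (f : T -> R) (K b : R) (A : set T) :
  measurable A -> measurable_fun [set: T] f -> (forall w, 0 <= f w <= K) ->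
  (forall t, `|rcov P \1_[set w | t <= f w] \1_A| <= b) ->
  `|rcov P f \1_A| <= K * b.
Proof.
move=> mA mf fK fb; apply/ler_addgt0Pr => /= e e0.
have K0 : 0 <= K by have /andP[h1 h2] := fK point; exact: le_trans h2.
(* With [D = K / Q.+1], the uniform approximation error costs at most [2 * D] in the covariance, and
   this [Q] makes [2 * D <= e]. *)
have [Q Qe] : exists Q, 2 * K / e <= Q.+1%:R.
  by exists (Num.truncn (2 * K / e)); exact/ltW/truncnS_gt.
have b0 : 0 <= b by apply: le_trans (fb 0).
have bA := bounded_rv_indic (R := R) mA.
have bf : bounded_rv f.
  by split=> //; exists K => w; have /andP[? ?] := fK w; rewrite ger0_norm.
have [K00|Kn0] := eqVneq K 0.
  have -> : f = fun=> 0.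
    by apply/funext => w; apply/eqP; rewrite eq_le andbC -[X in _ && (_
      <= X)]K00.
  by rewrite rcov_cstl// normr0 K00 mul0r add0r ltW.
have Kgt0 : 0 < K by rewrite lt_neqAle eq_sym Kn0.
pose D := K / Q.+1%:R; have D0 : 0 < D by exact: divr_gt0.
pose U q := [set w | q%:R * D <= f w].
have mU q : measurable (U q).
  rewrite -[U q]setTI; exact: measurable_fun_le (measurable_cst _) mf.
have bU q : bounded_rv (fun w => D * \1_(U q) w) by
  exact/bounded_rvZ/bounded_rv_indic.
pose h w := \sum_(1 <= q < Q.+2) D * \1_(U q) w.
have bh : bounded_rv h by apply: bounded_rv_sum => q _.
have hE w : h w = D * (minn Q.+1 (Num.truncn (f w / D)))%:R.
  have /andP[fw0 _] := fK w.
  have y0 : 0 <= f w / D by rewrite divr_ge0// ltW.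
  rewrite -staircase// mulr_sumr; apply: eq_bigr => q _.
  rewrite indicE ler_pdivlMr//; congr (_ * _%:R).
  by congr nat_of_bool; apply/idP/idP => [/set_mem//|?]; exact/mem_set.
have fh w : `|f w - h w| <= D.
  have /andP[fw0 fwK] := fK w.
  have y0 : 0 <= f w / D by rewrite divr_ge0// ltW.
  have /andP[t1 t2] := truncn_itv y0.
  (* As [f w <= K = Q.+1 * D], the cap at [Q.+1] is inactive: [h w] is [f w] rounded down to a
     multiple of [D]. *)
  rewrite hE (minn_idPr _); last first.
    rewrite -(ler_nat R) (le_trans t1)// ler_pdivrMr// /D mulrCA divff ?mulr1//.
  have fE : f w = D * (f w / D) by rewrite mulrC divfK// gt_eqF.
  rewrite [X in X - _]fE -mulrBr normrM (gtr0_norm D0) ler_piMr ?(ltW D0)//.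
  by rewrite ger0_norm ?subr_ge0// lerBlDl natr1 ltW.
have -> : rcov P f \1_A = rcov P (fun w => f w - h w) \1_A + rcov P h \1_A.
  by rewrite rcovBl// subrK.
rewrite (le_trans (ler_normD _ _))// addrC lerD//.
  (* The [Q.+1] level sets contribute at most [D * b] each, hence [K * b] in total. *)
  rewrite rcov_suml// (le_trans (ler_norm_sum _ _ _))//.
  rewrite (_ : K * b = \sum_(1 <= q < Q.+2) D * b); last first.
    rewrite sumr_const_nat subSS subn0 -mulr_natr mulrAC.
    by congr (_ * _); rewrite /D divfK.
  apply: ler_sum => q _; rewrite rcovZl//; last exact: bounded_rv_indic.
  by rewrite normrM (gtr0_norm D0) ler_pM2l//; exact: fb.
have PA1 : fine (P A) <= 1.
  by rewrite -lee_fin fineK ?fin_num_measure// probability_le1.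
have mfh : measurable_fun [set: T] (fun w =>
  f w - h w) by case: (bounded_rvB bf bh).
apply: (le_trans (le_normr_rcov_indic P mA mfh fh)).
rewrite (le_trans (_ : _ <= 2 * D))//; first by rewrite ler_piMr// mulr_ge0//
  ltW.
by rewrite /D mulrA ler_pdivrMr// -ler_pdivrMl// mulrC.
Qed.

(** Adding [M] keeps the covariance and moves the values into [[0, 2 * M]]; the level sets only
    change their threshold. *)
Lemma le_rcov_of_indic (f : T -> R) (M b : R) (A : set T) :
  measurable A -> measurable_fun [set: T] f -> (forall w, `|f w| <= M) ->
  (forall t, `|rcov P \1_[set w | t <= f w] \1_A| <= b) ->
  `|rcov P f \1_A| <= 2 * M * b.
Proof.
move=> mA mf fM fb; have bA := bounded_rv_indic (R := R) mA.
have bf : bounded_rv f by split => //; exists M.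
have -> : rcov P f \1_A = rcov P (fun w => f w + M) \1_A.
  by rewrite rcovDl ?rcov_cstl ?addr0//; exact: bounded_rv_cst.
apply: le_rcov_level_sets => // [|w|t].
- exact: measurable_funD.
- by have := fM w; rewrite ler_norml => /andP[? ?]; apply/andP; split; lra.
- rewrite (_ : [set w | _] = [set w | t - M <= f w])//.
  by apply/seteqP; split=> w /=; rewrite lerBlDr.
Qed.
End mixing_bounds.

(** * Rows of the array *)

Section rows.
Context {R : realType} {E : normedModType R}.
Context {d : measure_display} {T : measurableType d}.
Implicit Type x : nat -> T -> E.

Lemma measurable_block x j m :
  (forall l, (l < m)%N ->
    measurable_fun [set: T] (x (j + l)%N : T -> borel E)) ->
  measurable_fun [set: T] (block x j m : T -> m.-tuple (borel E)).
Proof.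
move=> mx; apply/measurable_fun_tnthP => i.
rewrite (_ : _ \o _ = x (j + i)%N); first exact: mx.
by apply/funext => w /=; rewrite tnth_mktuple.
Qed.

Lemma measurable_nonzero : measurable ([set y | y != 0] : set (borel E)).
Proof.
apply: sub_sigma_algebra.
rewrite (_ : [set y | y != 0] = ~` [set 0]); last first.
  by apply/seteqP; split=> y /=; [move/eqP|move=> /eqP].
by rewrite openC;
  exact/accessible_closed_set1/hausdorff_accessible/norm_hausdorff.
Qed.

Lemma measurable_nonzero_event x i :
  measurable_fun [set: T] (x i : T -> borel E) ->
  measurable [set w | x i w != 0].
Proof. by move=> mx; have := mx measurableT _ measurable_nonzero;
  rewrite setTI. Qed.

Variables (g : seq E -> R) (M : R).
Hypotheses (mg : measurable_functional g)
  (gM : forall y, y != [::] -> `|g y| <= M).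

Lemma measurable_functional_block x j m : (0 < m)%N ->
  (forall l, (l < m)%N ->
    measurable_fun [set: T] (x (j + l)%N : T -> borel E)) ->
  measurable_fun [set: T] (fun w => g (block x j m w)).
Proof. by move=> m0 /measurable_block; exact: (measurableT_comp (mg m0)). Qed.

Lemma le_normr_functional_block x j m w : (0 < m)%N ->
  `|g (block x j m w)| <= M.
Proof. by move=> m0; apply: gM; rewrite -size_eq0 size_tuple -lt0n. Qed.

End rows.

(** * Sigma-fields of a row and covariances across a gap *)

Section sigma_fields.
Context {R : realType} {E : normedModType R}.
Context {d : measure_display} {T : measurableType d}.
Implicit Type x : nat -> T -> E.

Lemma sigma_algebra_sigma_field x i j : sigma_algebra [set: T] (sigma_field x
  i j).
Proof. exact: smallest_sigma_algebra. Qed.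

Lemma sigma_field_measurable n x i j : random_row n x -> (0 < i)%N ->
  (j <= n)%N ->
  sigma_field x i j `<=` measurable.
Proof.
move=> rx i0 jn; apply: smallest_sub; first exact: sigma_algebra_measurable.
move=> A [l /= /andP[il lj]] [B mB <-]; apply: rx => //.
by rewrite (leq_trans i0 il) (leq_trans lj jn).
Qed.

Lemma measurable_sigma_field x i j l : (i <= l <= j)%N ->
  measurable_fun [set: g_sigma_algebraType (sigma_field x i j)]
    (x l : T -> borel E).
Proof.
move=> ilj _ B mB; rewrite sigma_algebraType_measurableE; last first.
  exact: sigma_algebra_sigma_field.
by apply: sub_sigma_algebra; exists l => //; exists B.
Qed.

(** The measurability of block functionals is applied to [T] equipped with this sigma-field instead
    of the ambient one. *)
Lemma sigma_field_level_set x i j (g : seq E -> R) p m t :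
  measurable_functional g -> (0 < m)%N -> (i <= p)%N -> (p + m <= j.+1)%N ->
  sigma_field x i j [set w | t <= g (block x p m w)].
Proof.
move=> mg m0 ip pmj; rewrite -sigma_algebraType_measurableE; last first.
  exact: sigma_algebra_sigma_field.
rewrite -[X in measurable X]setTI.
have mgb : measurable_fun [set: g_sigma_algebraType (sigma_field x i j)]
    (fun w => g (block x p m w)).
  apply: (measurable_functional_block
    (T := g_sigma_algebraType (sigma_field x i j)) mg m0).
  by move=> l lm; apply: measurable_sigma_field; lia.
exact: measurable_fun_le (measurable_cst _) mgb.
Qed.

Lemma sigma_field_nonzero x i j l : (i <= l <= j)%N ->
  sigma_field x i j [set w | x l w != 0].
Proof.
move=> ilj; rewrite -sigma_algebraType_measurableE; last first.
  exact: sigma_algebra_sigma_field.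
apply: (measurable_nonzero_event
  (T := g_sigma_algebraType (sigma_field x i j))).
exact: measurable_sigma_field.
Qed.

Variables (P : probability T R) (n : nat) (x : nat -> T -> E).
Hypothesis rx : random_row n x.

Lemma beta_mixing_ge0 q : (0 <= beta_mixing P n x q)%E.
Proof. exact: bigmax_ge_id. Qed.

(** The integral of the essential supremum at [l] bounds the covariance and is one of the terms of
    the maximum defining the coefficient. *)
Lemma le_rcov_beta_mixing q l A B : (1 <= l < n - q)%N ->
  sigma_field x 1 l A -> sigma_field x (l + q + 1) n B ->
  (`|rcov P \1_A \1_B|%:E <= beta_mixing P n x q)%E.
Proof.
move=> /andP[l1 lnq] GA HB.
have sub1 : sigma_field x 1 l `<=` measurable.
  by apply: (sigma_field_measurable rx) => //; lia.
have sub2 : sigma_field x (l + q + 1) n `<=` measurable.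
  by apply: (sigma_field_measurable rx) => //; lia.
apply: le_trans (le_rcov_indic_ess_sup P (sigma_algebra_sigma_field _ _ _)
  sub1 sub2 GA HB) _.
have -> : beta_mixing P n x q = \big[maxe/0%E]_(1 <= p < n - q)
  (fun p => \int[P]_w ess_sup_family P
  [set (fun w => `|cond_prob P (sigma_field x 1 p) B w - fine (P B)|%:E)
     | B in sigma_field x (p + q + 1) n] w)%E p by [].
by apply: (@le_bigmax_seq _ _ _ _ _ l xpredT); rewrite // mem_index_iota l1.
Qed.

Variables (g : seq E -> R) (M : R).
Hypotheses (mg : measurable_functional g)
  (gM : forall y, y != [::] -> `|g y| <= M).
Variables (s q : nat) (b : R).
Hypotheses (s0 : (0 < s)%N) (bq : (beta_mixing P n x q <= b%:E)%E).

(** The observation is the past, with [l = i], and the block starts [q + 1] steps later. Mixing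
    bounds the level sets of the block functional, and [le_rcov_of_indic] passes to the functional
    itself. *)
Lemma le_rcov_block_after i j : (0 < i)%N -> j = (i + q).+1 ->
  (j + s <= n.+1)%N ->
  `|rcov P (fun w => g (block x j s w)) \1_[set w | x i w != 0]| <= 2 * M * b.
Proof.
move=> i0 jE jn; apply: le_rcov_of_indic.
- by apply/measurable_nonzero_event/rx; lia.
- by apply: measurable_functional_block => // l ls; apply: rx; lia.
- by move=> w; exact: le_normr_functional_block.
- move=> t; rewrite rcovC -lee_fin; apply: le_trans bq.
  apply: (@le_rcov_beta_mixing _ i); first by lia.
  + by apply: sigma_field_nonzero; lia.
  + by apply: sigma_field_level_set => //; lia.
Qed.

(** Here the block is the past, ending at [l = j + s - 1], and the observation comes [q + 1] steps
    later. *)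
Lemma le_rcov_block_before i j : (0 < j)%N -> i = (j + s + q)%N -> (i <= n)%N ->
  `|rcov P (fun w => g (block x j s w)) \1_[set w | x i w != 0]| <= 2 * M * b.
Proof.
move=> j0 iE leqin; apply: le_rcov_of_indic.
- by apply/measurable_nonzero_event/rx; lia.
- by apply: measurable_functional_block => // l ls; apply: rx; lia.
- by move=> w; exact: le_normr_functional_block.
- move=> t; rewrite -lee_fin; apply: le_trans bq.
  apply: (@le_rcov_beta_mixing _ (j + s).-1); first by lia.
  + by apply: sigma_field_level_set => //; lia.
  + by apply: sigma_field_nonzero; lia.
Qed.

End sigma_fields.

(** * Block sums and counts started at an offset *)

Section block_sums.
Context {R : realType} {E : normedModType R}.

(** The variable [D_h] of the outline. The space [T] is an argument, so that the definition also
    applies to the coordinate process on tuples. *)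
Definition offset_disjoint_sum (g : seq E -> R)
    d (T : measurableType d) (x : nat -> T -> E) (s m h : nat) (w : T) : R :=
  \sum_(0 <= j < m) g (block x (j * s + h).+1 s w).

Definition offset_count d (T : measurableType d) (x : nat -> T -> E)
  (r h : nat) (w : T) : R :=
  \sum_(0 <= i < r) (x (h + i).+1 w != 0)%:R.

(* The sums over a row are sums over the coordinate process, evaluated at a
   block of the row; this reduces their shift invariance to stationarity. *)
Definition coordinate k (i : nat) (t : k.-tuple (borel E)) : E :=
  nth 0 (t : seq E) i.-1.

Context {d : measure_display} {T : measurableType d}.
Variables (g : seq E -> R) (s : nat).
Implicit Type x : nat -> T -> E.

Lemma block_coordinate x k h j m w : (0 < j)%N -> (j + m <= k.+1)%N ->
  block (@coordinate k) j m (block x h.+1 k w) = block x (h + j) m w.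
Proof.
move=> j0 jm; apply: eq_from_tnth => i; rewrite !tnth_mktuple /coordinate.
have ik : ((j + i).-1 < k)%N by have := ltn_ord i; lia.
rewrite -(tnth_nth 0 _ (Ordinal ik)) tnth_mktuple /=; congr (x _ w).
by lia.
Qed.

Lemma offset_disjoint_sum_coordinate x k m h w : (m * s <= k)%N ->
  offset_disjoint_sum g x s m h w =
  offset_disjoint_sum g (@coordinate k) s m 0 (block x h.+1 k w).
Proof.
move=> mk; apply: eq_big_nat => j /andP[_ jm].
have := leq_mul2r s j.+1 m; rewrite jm orbT mulSn => jm'.
by rewrite block_coordinate ?addn0 ?addnS// ?(addnC h)//; lia.
Qed.

Lemma offset_count_coordinate x k r h w : (r <= k)%N ->
  offset_count x r h w = offset_count (@coordinate k) r 0 (block x h.+1 k w).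
Proof.
move=> rk; apply: eq_big_nat => i /andP[_ ir]; rewrite /coordinate add0n.
have ik : (i < k)%N by lia.
by rewrite -[nth _ _ _](tnth_nth 0 _ (Ordinal ik)) tnth_mktuple addSn.
Qed.

Lemma measurable_coordinate k i : (0 < i <= k)%N ->
  measurable_fun [set: k.-tuple (borel E)] (@coordinate k i : _ -> borel E).
Proof.
move=> /andP[i0 ik]; have ik' : (i.-1 < k)%N by lia.
rewrite (_ : coordinate i = (@tnth k (borel E))^~ (Ordinal ik')).
  exact: measurable_tnth.
by apply/funext => t; rewrite (tnth_nth 0).
Qed.

Lemma nonzeroE x i w : (x i w != 0)%:R = \1_[set w | x i w != 0] w :> R.
Proof.
rewrite indicE; congr (_%:R); congr nat_of_bool.
by apply/idP/idP => [?|/set_mem//]; exact/mem_set.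
Qed.

Lemma bounded_nonzero x i : measurable_fun [set: T] (x i : T -> borel E) ->
  bounded_rv (fun w => (x i w != 0)%:R : R).
Proof.
move=> mx; rewrite (_ : (fun w => _) = \1_[set w | x i w != 0]).
  exact/bounded_rv_indic/measurable_nonzero_event.
by apply/funext => w; exact: nonzeroE.
Qed.

Lemma bounded_offset_count n x r h : random_row n x -> (r + h <= n)%N ->
  bounded_rv (offset_count x r h).
Proof.
move=> rx rhn; apply: bounded_rv_sum => i;
  rewrite mem_index_iota => /andP[_ ir].
by apply/bounded_nonzero/rx; lia.
Qed.

Variables (M : R).
Hypotheses (mg : measurable_functional g)
  (gM : forall y, y != [::] -> `|g y| <= M).
Hypothesis s0 : (0 < s)%N.

Lemma bounded_functional_block x j :
  (forall l, (l < s)%N ->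
    measurable_fun [set: T] (x (j + l)%N : T -> borel E)) ->
  bounded_rv (fun w => g (block x j s w)).
Proof.
move=> mx; split; first exact: measurable_functional_block.
by exists M => w; exact: le_normr_functional_block.
Qed.

Lemma bounded_offset_disjoint_sum n x m h : random_row n x ->
  (m * s + h <= n)%N ->
  bounded_rv (offset_disjoint_sum g x s m h).
Proof.
move=> rx mhn; apply: bounded_rv_sum => j;
  rewrite mem_index_iota => /andP[_ jm].
have := leq_mul2r s j.+1 m; rewrite jm orbT mulSn => jm'.
by apply: bounded_functional_block => l ls; apply: rx; lia.
Qed.

End block_sums.

(** * Shift invariance of integrals and covariances *)

Section stationary_rows.
Context {R : realType} {E : normedModType R}.
Context {d : measure_display} {T : measurableType d}.
Variables (P : probability T R) (n : nat) (x : nat -> T -> E).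
Hypotheses (rx : random_row n x) (sx : stationary P n x).

(** Both sides integrate [F] against the law of a block, and stationarity says that the two laws
    agree on measurable sets. *)
Lemma stationary_Rintegral k h (F : k.-tuple (borel E) -> R) :
  (k + h <= n)%N -> bounded_rv F ->
  \int[P]_w F (block x h.+1 k w) = \int[P]_w F (block x 1 k w).
Proof.
move=> khn bF.
have mb j : (0 < j)%N -> (j + k <= n.+1)%N ->
    measurable_fun [set: T] (block x j k : T -> k.-tuple (borel E)).
  by move=> j0 jk; apply: measurable_block => l lk; apply: rx; lia.
have bc j : (0 < j)%N -> (j + k <= n.+1)%N ->
  bounded_rv (fun w => F (block x j k w)).
  move=> j0 jk; split; first by apply: measurableT_comp (mb _ j0 jk); case: bF.
  by case: bF => _ [K FK]; exists K => w.
have mF : measurable_fun setT (EFin \o F) by apply/measurable_EFinP; case: bF.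
have push j (j0 : (0 < j)%N) (jk : (j + k <= n.+1)%N) :
    (\int[P]_w (F (block x j k w))%:E =
     \int[pushforward P (block x j k : T -> k.-tuple (borel E))]_t (F t)%:E)%E.
  by rewrite (integral_pushforward (mb _ j0 jk) mF (bounded_rv_integrable P
    (bc _ j0 jk))).
rewrite /Rintegral !push; [|lia..]; congr fine.
apply: eq_measure_integral => [||m1 m2 A mA _]; [apply: mb; lia..|exact: sx].
Qed.

Lemma stationary_rcov k h (F F' : k.-tuple (borel E) -> R) :
  (k + h <= n)%N -> bounded_rv F -> bounded_rv F' ->
  rcov P (fun w => F (block x h.+1 k w)) (fun w => F' (block x h.+1 k w)) =
  rcov P (fun w => F (block x 1 k w)) (fun w => F' (block x 1 k w)).
Proof.
move=> khn bF bF'; rewrite /rcov !(stationary_Rintegral khn)//.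
by rewrite (stationary_Rintegral khn (bounded_rvM bF bF')).
Qed.

Lemma stationary_nonzero_prob i : (0 < i <= n)%N ->
  fine (P [set w | x i w != 0]) = nonzero_prob P x.
Proof.
case: i => // i /andP[_ ileqn]; rewrite /nonzero_prob; congr fine.
pose A := [set t : 1.-tuple (borel E) | coordinate 1 t != 0 :> E].
have mA : measurable A.
  by apply: measurable_nonzero_event; exact: measurable_coordinate.
have AE j : [set w | x j w != 0] = [set w | A (block x j 1 w)].
  apply/seteqP; split => w; rewrite /A /coordinate /=;
  by rewrite -[nth _ _ _](tnth_nth 0 (block x j 1 w) ord0) tnth_mktuple addn0.
by rewrite !AE; apply: sx => //; rewrite add1n.
Qed.

End stationary_rows.

(** * The effect of shifting the counting window *)

Lemma big_nat_shift (R : zmodType) (f : nat -> R) a m :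
  \sum_(a <= i < a + m) f i = \sum_(0 <= i < m) f (a + i)%N.
Proof.
rewrite -{1}(add0n a) big_addn addKn; apply: eq_bigr => i _.
by rewrite addnC.
Qed.

(** Euclidean division by [s]. It serves to sort the sliding blocks by the residue of their start
    and to enumerate gaps. *)
Lemma sum_residues (R : zmodType) (f : nat -> R) m s :
  \sum_(0 <= u < s) \sum_(0 <= j < m) f (j * s + u)%N =
  \sum_(0 <= q < m * s) f q.
Proof.
rewrite exchange_big_nat; elim: m => [|m IH]; first by rewrite mul0n !big_geq.
rewrite big_nat_recr//= IH mulSnr (@big_cat_nat _ _ _ (m * s)%N 0 (m * s +
  s))//= ?leq_addr//.
by rewrite (big_nat_shift f (m * s)).
Qed.

(* [c i j] stands for the absolute covariance of the [j]-th block with the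
   [i]-th observation near an end, and [f q] for a bound valid across a gap
     [q]. *)
Section gap_counting.
Context {R : numDomainType}.
Variables (f : nat -> R) (c : nat -> nat -> R) (m s h : nat).
Hypotheses (f0 : forall q, 0 <= f q) (hs : (h <= s)%N).

(** The total bound over the gaps below [m * s] with residue [u] modulo [s]. *)
Let F u := \sum_(0 <= j < m) f (j * s + u)%N.
Let F0 u : 0 <= F u. Proof. exact: sumr_ge0. Qed.

(** The gap has quotient [j] and residue [h - i.+1] modulo [s]. Different [i] give different
    residues, so no gap occurs twice. *)
Lemma le_sum_gaps_after :
  (forall i j, (i < h)%N -> (j < m)%N -> c i j <= f (j * s + (h - i.+1))%N) ->
  \sum_(0 <= i < h) \sum_(0 <= j < m) c i j <= \sum_(0 <= q < m * s) f q.
Proof.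
move=> cf; rewrite -sum_residues.
apply: (@le_trans _ _ (\sum_(0 <= i < h) F (h - i.+1))).
  by apply: ler_sum_nat => i /andP[_ ih]; apply: ler_sum_nat => j /andP[_ jm];
    exact: cf.
rewrite (_ : \sum_(0 <= i < h) F (h - i.+1) = \sum_(0 <= u < h) F u);
  last first.
  by rewrite [RHS]big_nat_rev/= add0n.
rewrite [leRHS](@big_cat_nat _ _ _ h 0 s)//= lerDl.
by apply: sumr_ge0 => u _; exact: F0.
Qed.

(** The residues are now [s - h + i], again distinct. The last block [m.-1] has no gap and costs [V]
    for each of at most [s] observations. *)
Lemma le_sum_gaps_before (V : R) : (0 < m)%N -> 0 <= V ->
  (forall i j, (i < h)%N -> (j.+1 < m)%N ->
    c i j <= f ((m.-1 - j.+1) * s + (s - h + i))%N) ->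
  (forall i, (i < h)%N -> c i m.-1 <= V) ->
  \sum_(0 <= i < h) \sum_(0 <= j < m) c i j
    <= \sum_(0 <= q < m * s) f q + s%:R * V.
Proof.
move=> m0 V0 cf cV; rewrite -sum_residues.
apply: (@le_trans _ _ (\sum_(0 <= i < h) (F (s - h + i)%N + V))).
  apply: ler_sum_nat => i /andP[_ ih].
  rewrite -[in leLHS](prednK m0) big_nat_recr//= lerD ?cV//.
  apply: (@le_trans _ _
    (\sum_(0 <= j < m.-1) f ((m.-1 - j.+1) * s + (s - h + i))%N)).
    by apply: ler_sum_nat => j /andP[_ jm]; apply: cf => //; lia.
  rewrite (_ : \sum_(0 <= j < m.-1) _ =
      \sum_(0 <= j < m.-1) f (j * s + (s - h + i))%N).
    by rewrite /F -[in leRHS](prednK m0) [leRHS]big_nat_recr//= lerDl.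
  by rewrite [RHS]big_nat_rev/= add0n.
rewrite big_split/= lerD//; last first.
  by rewrite sumr_const_nat subn0 mulr_natl; exact: ler_wpMn2l.
rewrite -big_nat_shift subnK// [leRHS](@big_cat_nat _ _ _ (s - h) 0 s)//=
  ?leq_subr// lerDr.
by apply: sumr_ge0 => u _; exact: F0.
Qed.

End gap_counting.

(** * Covariance error caused by shifting the blocks *)

Section shift_error.
Context {R : realType} {E : normedModType R}.
Context {d : measure_display} {T : measurableType d}.
Variables (P : probability T R) (n : nat) (x : nat -> T -> E).
Hypotheses (rx : random_row n x) (sx : stationary P n x).
Variables (g : seq E -> R) (M : R).
Hypotheses (mg : measurable_functional g)
  (gM : forall y, y != [::] -> `|g y| <= M).
Variables (s m k : nat) (b : nat -> R).
Hypotheses (s0 : (0 < s)%N) (m0 : (0 < m)%N) (rn : (m * s + s <= n)%N).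
Hypothesis b0 : forall q, 0 <= b q.
Hypothesis betab : forall q, (k <= q <= m * s)%N ->
  (beta_mixing P n x q <= (b q)%:E)%E.

Let v := nonzero_prob P x.
Let v0 : 0 <= v. Proof. exact: fine_ge0. Qed.
Let M0 : 0 <= M. Proof. by apply: le_trans (gM (y := [:: 0]) _). Qed.

Let gap_bound q := 2 * M * (if (q < k)%N then v else b q).

Let gap_bound_ge0 q : 0 <= gap_bound q.
Proof. by rewrite mulr_ge0 ?mulr_ge0//; case: ifP. Qed.

(** Valid for every position of the observation relative to the block, even inside it; stationarity
    turns the probability of a nonzero observation into [v]. *)
Lemma le_rcov_block_nonzero i j : (0 < i <= n)%N -> (0 < j)%N ->
  (j + s <= n.+1)%N ->
  `|rcov P (fun w => g (block x j s w)) \1_[set w | x i w != 0]| <= 2 * M * v.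
Proof.
move=> /andP[i0 ileqn] j0 jn; rewrite /v -(stationary_nonzero_prob sx (i :=
  i)) ?i0//.
apply: le_normr_rcov_indic.
- by apply/measurable_nonzero_event/rx; rewrite i0.
- by apply: measurable_functional_block => // l ls; apply: rx; lia.
- by move=> w; exact: le_normr_functional_block.
Qed.

Let c h i j : R :=
  `|rcov P (fun w => g (block x (j * s + h).+1 s w)) \1_[set w | x i.+1 w !=
    0]|.

Let block_lt j : (j < m)%N -> (j * s + s <= m * s)%N.
Proof. by move=> jm; have := leq_mul2r s j.+1 m; rewrite jm orbT mulSnr. Qed.

Lemma le_sum_rcov_start h : (h <= s)%N ->
  \sum_(0 <= i < h) \sum_(0 <= j < m) c h i j
    <= \sum_(0 <= q < m * s) gap_bound q.
Proof.
move=> hs; apply: (le_sum_gaps_after gap_bound_ge0 hs) => i j ih jm.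
have jmr := block_lt jm; rewrite /gap_bound; case: ifPn => qk.
  by apply: le_rcov_block_nonzero; lia.
by apply: (le_rcov_block_after rx mg gM s0 (betab _)); lia.
Qed.

Lemma le_sum_rcov_end h : (h <= s)%N ->
  \sum_(0 <= i < h) \sum_(0 <= j < m) c h (m * s + i)%N j
    <= \sum_(0 <= q < m * s) gap_bound q + s%:R * (2 * M * v).
Proof.
move=> hs; apply: (@le_sum_gaps_before _ gap_bound (fun i j =>
  c h (m * s + i)%N j) _ _ _ gap_bound_ge0 hs) => //.
- by rewrite !mulr_ge0.
- move=> i j ih jm.
  (* The identity [m = (m.-1 - j.+1) + j.+1 + 1], multiplied by [s], makes the comparison of
     positions linear. *)
  have mE : (m * s = (m.-1 - j.+1) * s + (j * s + s) + s)%N.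
    by rewrite -mulSnr -mulnDl -mulSnr; congr (_ * _)%N; lia.
  rewrite /gap_bound; case: ifPn => qk.
    by apply: le_rcov_block_nonzero; lia.
  by apply: (le_rcov_block_before rx mg gM s0 (betab _)); lia.
(* The last block contains the observation, so only the bound by [v] applies. *)
- move=> i ih; have := @block_lt m.-1; move: (m.-1 : nat) (ltn_predL m) => p.
  by rewrite m0 => pm /(_ pm) ?; apply: le_rcov_block_nonzero; lia.
Qed.

Lemma sum_gap_bound : \sum_(0 <= q < m * s) gap_bound q
    <= 2 * M * (k%:R * v + \sum_(k <= q < (m * s).+1) b q).
Proof.
rewrite -mulr_sumr ler_wpM2l ?mulr_ge0//.
have [kr|kr] := leqP k (m * s).
  rewrite (@big_cat_nat _ _ _ k 0 (m * s))//= lerD//.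
    rewrite mulr_natl -[k in leRHS]subn0 -sumr_const_nat.
    by apply: ler_sum_nat => q /andP[_ ->].
  (* The right-hand sum has the additional nonnegative term at [q = m * s]. *)
  rewrite big_nat_recr//= -[leLHS]addr0 lerD//.
  by apply: ler_sum_nat => q /andP[kq _]; rewrite ltnNge kq.
(* For [k > m * s] all gaps are short and the sum of the [b q] is empty. *)
rewrite [X in _ + X]big_geq// addr0 mulr_natl.
apply: (@le_trans _ _ (\sum_(0 <= q < m * s) v)).
  by apply: ler_sum_nat => q /andP[_ qm]; rewrite (ltn_trans qm kr).
by rewrite sumr_const_nat subn0; apply: ler_wpMn2l => //; exact: ltnW.
Qed.

Let Dh := offset_disjoint_sum g x s m.
Let Nh := offset_count x (m * s) : nat -> T -> R.

Let block_bounded h j : (h <= s)%N -> (j < m)%N ->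
  bounded_rv (fun w => g (block x (j * s + h).+1 s w)).
Proof.
move=> hs jm; have jmr := block_lt jm.
by apply: (bounded_functional_block mg gM s0) => l ls; apply: rx; lia.
Qed.

Let nonzero_bounded i : (i < n)%N -> bounded_rv (fun w =>
  (x i.+1 w != 0)%:R : R).
Proof. by move=> ileqn; apply/bounded_nonzero/rx. Qed.

Let Dh_bounded h : (h <= s)%N -> bounded_rv (Dh h).
Proof. by move=> hs; apply: (bounded_offset_disjoint_sum mg gM s0 rx); lia. Qed.

Let Nh_bounded h : (h <= s)%N -> bounded_rv (Nh h).
Proof. by move=> hs; apply: (bounded_offset_count rx); lia. Qed.

(** [D_h] and [N_h] are a fixed pair of functionals of the coordinate process, evaluated at the
    block of length [m * s] starting at [h.+1]. *)
Lemma rcov_offset_shift h : (h <= s)%N -> rcov P (Dh h)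
  (Nh h) = rcov P (Dh 0) (Nh 0).
Proof.
move=> hs; pose y := @coordinate R E (m * s).
have ry : random_row (m * s) y by move=> i; exact: measurable_coordinate.
have bD : bounded_rv (offset_disjoint_sum g y s m 0).
  by apply: (bounded_offset_disjoint_sum mg gM s0 ry); rewrite addn0.
have bN : bounded_rv (offset_count y (m * s) 0 : _ -> R).
  by apply: (bounded_offset_count ry); rewrite addn0.
have DE l : Dh l = fun w => offset_disjoint_sum g y s m 0 (block x l.+1 (m *
  s) w).
  by apply/funext => w; exact: offset_disjoint_sum_coordinate.
have NE l : Nh l = fun w => offset_count y (m * s) 0 (block x l.+1 (m * s) w).
  by apply/funext => w; exact: offset_count_coordinate.
by rewrite !DE !NE; apply: (stationary_rcov rx sx) => //; lia.
Qed.

Lemma rcov_offset_disjoint_sum h : (h <= s)%N -> rcov P (Dh h)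
  (Dh h) = rcov P (Dh 0) (Dh 0).
Proof.
move=> hs; pose y := @coordinate R E (m * s).
have ry : random_row (m * s) y by move=> i; exact: measurable_coordinate.
have bD : bounded_rv (offset_disjoint_sum g y s m 0).
  by apply: (bounded_offset_disjoint_sum mg gM s0 ry); rewrite addn0.
have DE l : Dh l = fun w => offset_disjoint_sum g y s m 0 (block x l.+1 (m *
  s) w).
  by apply/funext => w; exact: offset_disjoint_sum_coordinate.
by rewrite !DE; apply: (stationary_rcov rx sx) => //; lia.
Qed.

Lemma le_rcov_offset_count h (a l : nat) : (h <= s)%N -> (a + l <= n)%N ->
  `|rcov P (Dh h) (fun w => \sum_(0 <= i < l) (x (a + i).+1 w != 0)%:R)|
    <= \sum_(0 <= i < l) \sum_(0 <= j < m) c h (a + i)%N j.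
Proof.
move=> hs aln; rewrite rcov_sumr; last 2 first.
- by move=> i; rewrite mem_index_iota => /andP[_ il]; apply: nonzero_bounded;
  lia.
- exact: Dh_bounded.
apply: le_trans (ler_norm_sum _ _ _) _; apply: ler_sum_nat => i /andP[_ il].
rewrite rcov_suml; last 2 first.
- by move=> j; rewrite mem_index_iota => /andP[_ jm]; exact: block_bounded.
- by apply: nonzero_bounded; lia.
apply: le_trans (ler_norm_sum _ _ _) _; apply: ler_sum_nat => j /andP[_ jm].
by rewrite /c (_ : (fun w => (_ != 0)%:R) = \1_[set w | x (a + i).+1 w != 0])//;
  apply/funext => w; exact: nonzeroE.
Qed.

(** The first summand comes from the last block, which overlaps the observations at the right end;
    the outer factor 2 of the second summand counts the two ends. *)
Definition shift_error : R := s%:R * (2 * M * v) +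
  2 * (2 * M * (k%:R * v + \sum_(k <= q < (m * s).+1) b q)).

(** Stationarity replaces the pair [D_0], [N_0] by [D_h], [N_h], which leaves the covariance of
    [D_h] with [N_0 - N_h]. This difference counts the first [h] observations minus the [h]
    observations after [m * s]. *)
Lemma le_shift_error h : (h <= s)%N ->
  `|rcov P (Dh h) (Nh 0) - rcov P (Dh 0) (Nh 0)| <= shift_error.
Proof.
move=> hs; rewrite -(rcov_offset_shift hs) -rcovBr;
  [|exact: Nh_bounded..|exact: Dh_bounded].
pose B a w : R := \sum_(0 <= i < h) (x (a + i).+1 w != 0)%:R.
have bB a : (a <= m * s)%N -> bounded_rv (B a).
  move=> am; apply: bounded_rv_sum => i; rewrite mem_index_iota => /andP[_ ih].
  by apply: nonzero_bounded; lia.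
have -> : (fun w => Nh 0 w - Nh h w) = (fun w => B 0%N w - B (m * s)%N w).
  apply/funext => w; pose f i : R := (x i.+1 w != 0)%:R.
  have e1 : \sum_(0 <= i < h + m * s) f i = B 0%N w + Nh h w.
    by rewrite (@big_cat_nat _ _ _ h 0 (h + m * s))//= ?leq_addr//
      (big_nat_shift f h).
  have e2 : \sum_(0 <= i < m * s + h) f i = Nh 0 w + B (m * s)%N w.
    by rewrite (@big_cat_nat _ _ _ (m * s) 0 (m * s + h))//= ?leq_addr//
      (big_nat_shift f (m * s)).
  by apply/eqP; rewrite subr_eq addrAC eq_sym subr_eq -e2 -e1 addnC.
rewrite rcovBr; [|exact: bB..|exact: Dh_bounded].
apply: le_trans (ler_normB _ _) _.
have l1 : `|rcov P (Dh h) (B 0%N)| <= \sum_(0 <= q < m * s) gap_bound q.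
  have hn : (0 + h <= n)%N by lia.
  exact: le_trans (le_rcov_offset_count hs hn) (le_sum_rcov_start hs).
have l2 : `|rcov P (Dh h) (B (m * s)%N)| <=
    \sum_(0 <= q < m * s) gap_bound q + s%:R * (2 * M * v).
  have hn : (m * s + h <= n)%N by lia.
  exact: le_trans (le_rcov_offset_count hs hn) (le_sum_rcov_end hs).
have l3 := sum_gap_bound.
by rewrite /shift_error; lra.
Qed.

End shift_error.

(** * Comparison of the sliding and the disjoint blocks sums *)

Section sums_as_offset_sums.
Context {R : realType} {E : normedModType R} {d : measure_display}
  {T : measurableType d}.
Variables (g : seq E -> R) (x : nat -> T -> E) (s m : nat).
Hypothesis s0 : (0 < s)%N.

Lemma sliding_sumE : sliding_sum g x s (m * s) =
  fun w => \sum_(0 <= h < s) offset_disjoint_sum g x s m h w.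
Proof.
apply/funext => w.
by rewrite /sliding_sum /offset_disjoint_sum big_add1 -(sum_residues _ m s).
Qed.

Lemma disjoint_sumE : disjoint_sum g x s (m * s) =
  offset_disjoint_sum g x s m 0.
Proof.
apply/funext => w; rewrite /disjoint_sum /offset_disjoint_sum mulnK// big_add1.
by apply: eq_bigr => j _; rewrite addn0.
Qed.

Lemma shifted_disjoint_sumE :
  shifted_disjoint_sum g x s (m * s) = offset_disjoint_sum g x s m s.
Proof.
apply/funext => w; rewrite /shifted_disjoint_sum /offset_disjoint_sum mulnK//.
by rewrite big_add1; apply: eq_bigr => j _; rewrite mulSnr.
Qed.

Lemma nonzero_countE r : nonzero_count x r = offset_count x r 0 :> (T -> R).
Proof. by apply/funext => w; rewrite /nonzero_count /offset_count big_add1. Qed.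

Lemma bounded_nonzero_count n r : random_row n x -> (r <= n)%N ->
  bounded_rv (nonzero_count x r : T -> R).
Proof.
by move=> rx rn; rewrite nonzero_countE; apply: (bounded_offset_count rx);
  rewrite addn0.
Qed.

End sums_as_offset_sums.

Section comparison.
Context {R : realType} {E : normedModType R}.
Context {d : measure_display} {T : measurableType d}.
Variables (P : probability T R) (n : nat) (x : nat -> T -> E).
Hypotheses (rx : random_row n x) (sx : stationary P n x).
Variables (g : seq E -> R) (M : R).
Hypotheses (mg : measurable_functional g)
  (gM : forall y, y != [::] -> `|g y| <= M).
Variables (s r : nat).
Hypotheses (s0 : (0 < s)%N) (r0 : (0 < r)%N) (sr : (s %| r)%N)
  (rn : (r + s <= n)%N).

Let S := sliding_sum g x s r.
Let D := disjoint_sum g x s r.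
Let D' := shifted_disjoint_sum g x s r.
Let N := nonzero_count x r : T -> R.

Let m := (r %/ s)%N.
Let rE : r = (m * s)%N. Proof. by rewrite divnK. Qed.
Let m0 : (0 < m)%N. Proof. by rewrite divn_gt0// dvdn_leq. Qed.

Let Dh_bounded h : (h <= s)%N -> bounded_rv (offset_disjoint_sum g x s m h).
Proof.
by move=> hs; apply: (bounded_offset_disjoint_sum mg gM s0 rx); rewrite -rE;
  lia.
Qed.

Lemma bounded_sliding_sum : bounded_rv S.
Proof.
rewrite /S rE sliding_sumE//; apply: bounded_rv_sum => h.
by rewrite mem_index_iota => /andP[_ /ltnW]; exact: Dh_bounded.
Qed.

Lemma bounded_disjoint_sum : bounded_rv D.
Proof. by rewrite /D rE disjoint_sumE//; exact: Dh_bounded. Qed.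

Lemma bounded_shifted_disjoint_sum : bounded_rv D'.
Proof. by rewrite /D' rE shifted_disjoint_sumE//; exact: Dh_bounded. Qed.

Lemma le_rcov_sliding_sum : rcov P S S <= s%:R ^+ 2 * rcov P D' D'.
Proof.
have mn : (m * s + s <= n)%N by rewrite -rE.
rewrite /S /D' rE sliding_sumE// shifted_disjoint_sumE//;
  apply: rcov_sum_le => h hs.
  by apply: Dh_bounded; exact: ltnW.
(* [D'] is [D_s], so its variance is the common variance of the [D_h]. *)
by rewrite !(rcov_offset_disjoint_sum rx sx mg gM s0 m0 mn)// ltnW.
Qed.

Variables (k : nat) (b : nat -> R).
Hypothesis b0 : forall q, 0 <= b q.
Hypothesis betab : forall q, (k <= q <= r)%N ->
  (beta_mixing P n x q <= (b q)%:E)%E.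

(** [S] is the sum of [D_0, ..., D_(s-1)] and [D] is [D_0], so the difference splits into [s]
    differences, each bounded by [shift_error]. *)
Lemma le_rcov_sliding_disjoint :
  `|rcov P S N - s%:R * rcov P D N| <= s%:R *
    (s%:R * (2 * M * nonzero_prob P x) +
     2 * (2 * M * (k%:R * nonzero_prob P x + \sum_(k <= q < r.+1) b q))).
Proof.
have mn : (m * s + s <= n)%N by rewrite -rE.
have bm q : (k <= q <= m * s)%N -> (beta_mixing P n x q <= (b q)%:E)%E.
  by rewrite -rE; exact: betab.
have bN : bounded_rv N by apply: (bounded_nonzero_count rx); lia.
rewrite /S /D /N rE sliding_sumE// disjoint_sumE// nonzero_countE.
rewrite /N rE nonzero_countE in bN.
rewrite rcov_suml//; last first.
  by move=> h; rewrite mem_index_iota => /andP[_ /ltnW]; exact: Dh_bounded.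
have const (C : R) : s%:R * C = \sum_(0 <= h < s) C.
  by rewrite sumr_const_nat subn0 mulr_natl.
set C := (X in _ <= _ * X); rewrite !const -sumrB
  (le_trans (ler_norm_sum _ _ _))//.
apply: ler_sum_nat => h /andP[_ /ltnW hs].
exact: (le_shift_error rx sx mg gM s0 m0 mn b0 bm hs).
Qed.

End comparison.

(** * Passage to real limits and proof of the comparison *)

Lemma littleo_ratio_cvg0 (R : realType) (f h : nat -> R) :
  f =o_\oo h -> f n / h n @[n --> \oo] --> (0 : R).
Proof.
move=> /eqoP fh; apply/cvgr0Pnorm_le => e e0.
have := fh _ e0; apply: filterS => n /= fhn.
(* Where [h n] vanishes the quotient is 0, since the inverse of 0 is 0. *)
rewrite normrM normfV; have [->|h0] := eqVneq (h n) 0.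
  by rewrite normr0 invr0 mulr0 ltW.
by rewrite ler_pdivrMr// normr_gt0.
Qed.

(** Turns the limits of extended-real moments into limits of reals; the moments are known to be
    finite only for large [n]. *)
Lemma fine_cvg_near (R : realType) (u : nat -> \bar R) (f : nat -> R) (l : R) :
  u @ \oo --> l%:E -> (\forall n \near \oo, u n = (f n)%:E) -> f @ \oo --> l.
Proof.
move=> /fine_cvg ul uf; apply: cvg_trans ul; apply: near_eq_cvg.
by apply: filterS uf => n /= ->.
Qed.

Section finite_sums_of_mixing_coefficients.
Context {R : realType} {d : measure_display} {T : measurableType d}.
Variables (P : probability T R) (E : normedModType R) (n : nat)
  (x : nat -> T -> E).

(** The default value [+oo] of the essential supremum leaves infinite coefficients possible a
    priori; nonnegativity bounds each one by the finite sum. *)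
Lemma beta_mixing_fin_num k r q :
  (\sum_(k <= i < r) beta_mixing P n x i \is a fin_num)%E -> (k <= q < r)%N ->
  beta_mixing P n x q \is a fin_num.
Proof.
move=> fin qr; rewrite ge0_fin_numE ?beta_mixing_ge0//.
move: fin; rewrite ge0_fin_numE ?sume_ge0//; last by move=> *;
  exact: beta_mixing_ge0.
apply: le_lt_trans; rewrite (bigD1_seq q) ?iota_uniq ?mem_index_iota//=.
by rewrite leeDl// sume_ge0// => i _; exact: beta_mixing_ge0.
Qed.

End finite_sums_of_mixing_coefficients.

Lemma cvg_fin_num_near (R : realType) (u : nat -> \bar R) (l : R) :
  u @ \oo --> l%:E -> \forall n \near \oo, u n \is a fin_num.
Proof. by move=> /fine_cvgP[]. Qed.

Theorem theorem2p6 (R : realType) (E : completeNormedModType R)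
    (d : measure_display) (T : measurableType d) (P : probability T R)
    (X : nat -> nat -> T -> E) (s r : nat -> nat) (a : nat -> R)
    (g : seq E -> R) (cs cd cv csv cdv xi : R)
    (v := fun n => nonzero_prob P (X n))
    (S := fun n => sliding_sum g (X n) (s n) (r n))
    (D := fun n => disjoint_sum g (X n) (s n) (r n))
    (D' := fun n => shifted_disjoint_sum g (X n) (s n) (r n))
    (N := fun n => nonzero_count (X n) (r n) : T -> R) :
  (* the array, the block lengths and the normalizing constants *)
  (forall n, random_row n (X n)) ->
  (forall n, (0 < n)%N -> (0 < s n)%N /\ (0 < r n)%N) ->
  (fun n => (s n)%:R : R) =o_\oo (fun n => (r n)%:R : R) ->
  (fun n => (r n)%:R : R) =o_\oo (fun n => n%:R : R) ->
  (forall n, (0 < n)%N -> 0 < v n) ->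
  v @ \oo --> (0 : R) ->
  (forall n, (0 < n)%N -> 0 < a n) ->
  measurable_functional g ->
  vanishes_on_null g ->
  (* the limits c^(s,v), c^(d,v) and c^(v) *)
  (((r n)%:R * v n * (s n)%:R * a n)^-1%:E * covariance P (S n) (N n))%E
    @[n --> \oo] --> csv%:E ->
  (((r n)%:R * v n * a n)^-1%:E * covariance P (D n) (N n))%E
    @[n --> \oo] --> cdv%:E ->
  (((r n)%:R * v n)^-1%:E * 'E_P[(fun w => N n w ^+ 2)%R])%E
    @[n --> \oo] --> cv%:E ->
  (* stationarity, and the limits c^(s) and c^(d) *)
  (forall n, (0 < n)%N -> stationary P n (X n)) ->
  (forall n, (0 < n)%N -> (s n %| r n)%N) ->
  (((r n)%:R * v n * (s n)%:R ^+ 2 * a n ^+ 2)^-1%:E * 'V_P[S n])%E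
    @[n --> \oo] --> cs%:E ->
  0 < cs ->
  (((r n)%:R * v n * a n ^+ 2)^-1%:E * 'V_P[D' n])%E
    @[n --> \oo] --> cd%:E ->
  (* the bias condition and the conditions on g, s, r and a *)
  (((s n)%:R * v n * a n)^-1%:E
     * 'E_P[(fun w => g (block (X n) 1 (s n) w))]
     * ((n%:R - (s n)%:R + 1) / n%:R)%:E)%E
    @[n --> \oo] --> xi%:E ->
  bounded_functional g ->
  constant_sign g ->
  (fun n => (s n)%:R : R) =o_\oo (fun n => (r n)%:R * a n : R) ->
  (s n)%:R * v n @[n --> \oo] --> (0 : R) ->
  (* the mixing condition *)
  (exists k : nat -> nat,
     (fun n => (k n)%:R : R) =o_\oo (fun n => (r n)%:R * a n : R) /\
     (((r n)%:R * v n * a n)^-1%:E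
        * \sum_(k n <= i < (r n).+1) beta_mixing P n (X n) i)%E
       @[n --> \oo] --> 0%E) ->
  asymptotic_variance cs cv csv xi <= asymptotic_variance cd cv cdv xi.

Proof.
move=> rx srpos sr rn vpos _ apos mg _ csvE cdvE _ sx sdvd csE _ cdE _.
move=> [M gM] _ sra _ [k [kra mix]].
have spos n : (0 < n)%N -> (0 < s n)%N by move=> /srpos[].
have rpos n : (0 < n)%N -> (0 < r n)%N by move=> /srpos[].
(* The shifted blocks fit into the row once [s n <= r n] and [r n <= n / 2]. *)
have large : \forall n \near \oo, (0 < n)%N /\ (r n + s n <= n)%N.
  have /eqoP/(_ _ ltr01) sr1 := sr.
  have /eqoP/(_ 2^-1 ltac:(by rewrite invr_gt0)) rn2 := rn.
  near=> n; have n0 : (0 < n)%N by near: n; exact: nbhs_infty_gt.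
  split => //; rewrite -(ler_nat R) natrD.
  have : `|(s n)%:R : R| <= 1 * `|(r n)%:R : R| by near: n.
  have : `|(r n)%:R : R| <= 2^-1 * `|n%:R : R| by near: n.
  by rewrite !normr_nat; lra.
have bS n : (0 < n)%N -> (r n + s n <= n)%N -> bounded_rv (S n).
  by move=> n0 rsn; apply: (bounded_sliding_sum (rx n) mg gM) => //; auto.
have bD n : (0 < n)%N -> (r n + s n <= n)%N -> bounded_rv (D n).
  by move=> n0 rsn; apply: (bounded_disjoint_sum (rx n) mg gM) => //; auto.
have bD' n : (0 < n)%N -> (r n + s n <= n)%N -> bounded_rv (D' n).
  by move=> n0 rsn; apply: (bounded_shifted_disjoint_sum (rx n) mg gM) => //;
    auto.
have bN n : (0 < n)%N -> (r n + s n <= n)%N -> bounded_rv (N n).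
  by move=> n0 rsn; apply: (bounded_nonzero_count (rx n)); lia.
have cs_cd : cs <= cd.
  have csE' : ((r n)%:R * v n * (s n)%:R ^+ 2 * a n ^+ 2)^-1 * rcov P (S n)
    (S n)
      @[n --> \oo] --> cs.
    apply: fine_cvg_near csE _; apply: filterS large => n [n0 rsn].
    by rewrite /variance bounded_covarianceE//; exact: bS.
  have cdE' : ((r n)%:R * v n * a n ^+ 2)^-1 * rcov P (D' n) (D' n)
      @[n --> \oo] --> cd.
    apply: fine_cvg_near cdE _; apply: filterS large => n [n0 rsn].
    by rewrite /variance bounded_covarianceE//; exact: bD'.
  apply: ler_cvg_to csE' cdE' _; apply: filterS large => n [n0 rsn].
  have s0 : 0 < (s n)%:R :> R by rewrite ltr0n spos.
  have r0 : 0 < (r n)%:R :> R by rewrite ltr0n rpos.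
  have := vpos _ n0; have := apos _ n0 => a0 v0.
  rewrite ler_pdivrMl ?mulr_gt0 ?exprn_gt0//.
  rewrite (_ : _ * (_ * rcov P (D' n) (D' n)) = (s n)%:R ^+ 2 * rcov P (D' n)
    (D' n)).
    by apply: (le_rcov_sliding_sum (rx n) (sx n n0) mg gM) => //; auto.
  by field; rewrite !gt_eqF.
have csv_cdv : csv = cdv.
  pose p n := ((r n)%:R * v n * (s n)%:R * a n)^-1 * rcov P (S n) (N n).
  pose q n := ((r n)%:R * v n * a n)^-1 * rcov P (D n) (N n).
  pose B n := fine (((r n)%:R * v n * a n)^-1%:E
    * \sum_(k n <= i < (r n).+1) beta_mixing P n (X n) i)%E.
  (* The bound of [le_rcov_sliding_disjoint] divided by [r n * v n * s n * a n]; [v n] cancels in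
     the first two terms. *)
  pose err n := 2 * M * ((s n)%:R / ((r n)%:R * a n))
    + 4 * M * ((k n)%:R / ((r n)%:R * a n)) + 4 * M * B n.
  have pE : p @ \oo --> csv.
    apply: fine_cvg_near csvE _; apply: filterS large => n [n0 rsn].
    by rewrite bounded_covarianceE//; [exact: bS|exact: bN].
  have qE : q @ \oo --> cdv.
    apply: fine_cvg_near cdvE _; apply: filterS large => n [n0 rsn].
    by rewrite bounded_covarianceE//; [exact: bD|exact: bN].
  have err0 : err @ \oo --> (0 : R).
    rewrite (_ : 0 = 2 * M * 0 + 4 * M * 0 + 4 * M * 0 :> R);
      last by rewrite !mulr0 !addr0.
    apply: cvgD; first apply: cvgD.
    - apply: cvgM; first exact: cvg_cst.
      exact: littleo_ratio_cvg0 sra.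
    - apply: cvgM; first exact: cvg_cst.
      exact: littleo_ratio_cvg0 kra.
    - apply: cvgM; first exact: cvg_cst.
      exact: fine_cvg mix.
  have pq : (fun n => p n - q n) @ \oo --> (0 : R).
    apply/norm_cvg0P; apply: (@squeeze_cvgr _ _ _ _ (cst 0) err) => //;
      last exact: cvg_cst.
    have := cvg_fin_num_near mix.
    apply: filter_app; apply: filterS large => n [n0 rsn] fin.
    rewrite normr_ge0/=.
    have s0 : 0 < (s n)%:R :> R by rewrite ltr0n spos.
    have r0 : 0 < (r n)%:R :> R by rewrite ltr0n rpos.
    have := vpos _ n0; have := apos _ n0 => a0 v0.
    (* The prefactor is positive, so an infinite sum would make the product infinite. *)
    have {}fin : (\sum_(k n <= i < (r n).+1) beta_mixing P n (X n) i)%E \is a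
      fin_num.
      move: fin; case: (X in (_ * X)%E) => [//||].
        by rewrite gt0_muley// lte_fin invr_gt0 !mulr_gt0.
      by rewrite gt0_muleNy// lte_fin invr_gt0 !mulr_gt0.
    pose b i := fine (beta_mixing P n (X n) i).
    have b0 i : 0 <= b i by exact/fine_ge0/beta_mixing_ge0.
    have betab i : (k n <= i <= r n)%N -> (beta_mixing P n (X n) i
      <= (b i)%:E)%E.
      by move=> kir; rewrite fineK//; exact: beta_mixing_fin_num fin _.
    have BE : B n = ((r n)%:R * v n * a n)^-1 * \sum_(k n <= i < (r n).+1) b i.
      rewrite /B fineM//; congr (_ * _); rewrite [RHS]big_nat sum_fine
        -?big_nat//.
      by move=> i kir; exact: beta_mixing_fin_num fin _.
    have := le_rcov_sliding_disjoint (rx n) (sx n n0) mg gM (spos _ n0)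
      (rpos _ n0)
      (sdvd _ n0) rsn b0 betab.
    rewrite -/(v n) -/(S n) -/(D n) -/(N n).
    have c0 : 0 < ((r n)%:R * v n * (s n)%:R * a n)^-1 by rewrite invr_gt0
      !mulr_gt0.
    have -> : p n - q n = ((r n)%:R * v n * (s n)%:R * a n)^-1 *
        (rcov P (S n) (N n) - (s n)%:R * rcov P (D n) (N n)).
      by rewrite /p /q; field; rewrite !gt_eqF.
    rewrite normrM (gtr0_norm c0) -(ler_pM2l c0) => /le_trans; apply.
    rewrite le_eqVlt; apply/orP; left; apply/eqP.
    by rewrite /err BE; field; rewrite !gt_eqF.
  have : (fun n => p n - q n) @ \oo --> csv - cdv by exact: cvgB.
  move=> /(cvg_unique _ pq) => /(_ (@norm_hausdorff _ _)).
  by move=> /eqP; rewrite eq_sym subr_eq0 => /eqP.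
(* The two asymptotic variances now differ only in [cs] and [cd]. *)
by rewrite /asymptotic_variance csv_cdv !lerD2r.
Unshelve. all: by end_near.
Qed.
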